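(* Let $m\ge3$ be an odd integer and $n=2m$, and let $\lambda\ge1$. Let $\varphi:(0,1)\to(0,\infty)$ be continuous with $\lim_{r\to0^+}\varphi(r)=\infty$. Then there exists a $C^\infty$ positive solution $u$ of $$0\le-\Delta^m u\le e^{u^\lambda}\quad\text{in }\mathbb{R}^n\setminus\{0\}$$ such that $u(x)\neq O(\varphi(|x|))$ as $x\to0$.
   Context: $\Delta^m$ is the $m$-fold iterated Laplacian. For positive functions, ''$u(x)\neq O(h(x))$ as $x\to0$'' means $\limsup_{x\to0} u(x)/h(x)=\infty$. *)

(* Defs.v *)
From Stdlib Require Import Reals List.
Open Scope R_scope.

Definition inRn (n : nat) (x : nat -> R) : Prop := forall i, (n <= i)%nat -> x i = 0.

Definition Rnorm (n : nat) (x : nat -> R) : R :=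
  sqrt (sum_f_R0 (fun i => x i ^ 2) (pred n)).

Definition punctured (n : nat) (x : nat -> R) : Prop := inRn n x /\ Rnorm n x <> 0.

Definition upd (x : nat -> R) (i : nat) (t : R) : nat -> R :=
  fun j => if Nat.eqb j i then t else x j.

(* D is the family of all iterated partial derivatives of D nil on the open
   set U, all of them continuous on U: D (i :: l) = d/dx_i (D l).
   Hence D nil is C^infinity on U. *)
Definition smooth_family (n : nat) (U : (nat -> R) -> Prop)
    (D : list nat -> (nat -> R) -> R) : Prop :=
  (forall l i x, (i < n)%nat -> U x ->
     derivable_pt_lim (fun t => D l (upd x i t)) (x i) (D (i :: l) x)) /\
  (forall l x, U x -> forall eps, 0 < eps -> exists delta, 0 < delta /\
     forall y, inRn n y -> U y -> Rnorm n (fun j => y j - x j) < delta ->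
       Rabs (D l y - D l x) < eps).

(* lapm n D k l = Delta^k (D l), computed from the derivative family D *)
Fixpoint lapm (n : nat) (D : list nat -> (nat -> R) -> R) (k : nat)
    (l : list nat) (x : nat -> R) : R :=
  match k with
  | O => D l x
  | S k' => sum_f_R0 (fun i => lapm n D k' (i :: i :: l) x) (pred n)
  end.

(* Main.v *)
(* Let w = ln (1 / (rho + |x - c|^2)) on R^(2m).  Conformal invariance gives
   (-Delta)^m w = (2m-1)! 4^m rho^m e^(2m w), and for rho = 0 the right side vanishes.
   With tau_j = 2^-(j+1), c_j = tau_j e_0 and rho_j <= tau_j^2 as small as we please, put
     T_j = ln (|x|^2 / (rho_j + |x - c_j|^2))  and
     u = 6m/|x|^2 + 6m + 1 + 2m sum_j T_j.
   All derivatives of T_j are O(tau_j) locally uniformly off the origin, so u is smooth, and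
   1/|x|^2 is m-polyharmonic there.  Since T_j >= -4 tau_j/|x|, the term 6m/|x|^2 + 6m absorbs
   2m ln |x|^2 and the negative parts of all but one T_j, whence u >= 2m w_j for every j; so the j-th term
   of -Delta^m u, namely 2m (2m-1)! 4^m rho_j^m e^(2m w_j), is at most tau_j e^u once rho_j is small,
   and -Delta^m u <= e^u <= e^(u^lambda) because u >= 1.  Finally u(c_j) >= 2m ln (tau_j^2/rho_j),
   which exceeds j phi(tau_j) for rho_j small. *)
Require Import Defs.
From Stdlib Require Import Reals List Lra Lia Factorial Ranalysis5 FunctionalExtensionality.
From Coquelicot Require Import Coquelicot.
Open Scope R_scope.

Definition nsq (n : nat) (x : nat -> R) : R := sum_f_R0 (fun i => x i ^ 2) (pred n).

(** * Derivatives and Laplacians of ln (rho + |x - c|^2) *)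

(* The algebra generated by the coordinates of z = x - c, the powers of 1/s and - ln s, where
   s = rho + |z|^2: it is closed under partial derivatives. *)
Inductive expr : Type :=
| Cst (c : R)
| Crd (i : nat)
| Inv (k : nat)
| Log
| Add (a b : expr)
| Mul (a b : expr).

Fixpoint eval (e : expr) (z : nat -> R) (s : R) : R :=
  match e with
  | Cst c => c
  | Crd i => z i
  | Inv k => (/ s) ^ k
  | Log => - ln s
  | Add a b => eval a z s + eval b z s
  | Mul a b => eval a z s * eval b z s
  end.

Fixpoint pd (i : nat) (e : expr) : expr :=
  match e with
  | Cst _ => Cst 0
  | Crd j => Cst (if Nat.eqb j i then 1 else 0)
  | Inv k => Mul (Cst (-2 * INR k)) (Mul (Crd i) (Inv (S k)))
  | Log => Mul (Cst (-2)) (Mul (Crd i) (Inv 1))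
  | Add a b => Add (pd i a) (pd i b)
  | Mul a b => Add (Mul (pd i a) b) (Mul a (pd i b))
  end.

Definition pds (l : list nat) (e : expr) : expr := fold_right pd e l.

Definition sq (n : nat) (c : nat -> R) (rho : R) (x : nat -> R) : R :=
  rho + nsq n (fun k => x k - c k).

Definition val (n : nat) (c : nat -> R) (rho : R) (e : expr) (x : nat -> R) : R :=
  eval e (fun k => x k - c k) (sq n c rho x).

Lemma upd_self (x : nat -> R) (i : nat) : upd x i (x i) = x.
Proof.
  apply functional_extensionality; intro j; unfold upd.
  destruct (Nat.eqb_spec j i); subst; reflexivity.
Qed.

Lemma derivable_pt_lim_crd (c x : nat -> R) (i j : nat) :
  derivable_pt_lim (fun t => upd x i t j - c j) (x i) (if Nat.eqb j i then 1 else 0).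
Proof.
  unfold upd; destruct (Nat.eqb j i).
  - replace 1 with (1 - 0) by ring.
    apply (derivable_pt_lim_minus (fun t => t) (fun _ => c j)).
    + apply derivable_pt_lim_id.
    + apply derivable_pt_lim_const.
  - apply (derivable_pt_lim_const (x j - c j)).
Qed.

(** The case N < i is included so that the induction on N can pass through partial sums that do not
    yet contain the varying coordinate. *)
Lemma derivable_pt_lim_sum_sq (c x : nat -> R) (i N : nat) :
  derivable_pt_lim (fun t => sum_f_R0 (fun k => (upd x i t k - c k) ^ 2) N) (x i)
    (if Nat.leb i N then 2 * (x i - c i) else 0).
Proof.
  assert (T : forall j, derivable_pt_lim (fun t => (upd x i t j - c j) ^ 2) (x i)
     (if Nat.eqb j i then 2 * (x i - c i) else 0)).
  { intro j.
    pose proof (derivable_pt_lim_comp _ (fun y => y ^ 2) _ _ _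
      (derivable_pt_lim_crd c x i j)
      (derivable_pt_lim_pow (upd x i (x i) j - c j) 2)) as H.
    unfold comp in H. rewrite upd_self in H. simpl INR in H. simpl pred in H.
    replace (if Nat.eqb j i then 2 * (x i - c i) else 0)
      with ((1 + 1) * (x j - c j) ^ 1 * (if Nat.eqb j i then 1 else 0)); [exact H|].
    destruct (Nat.eqb_spec j i); subst; ring. }
  induction N as [|N IH]; simpl sum_f_R0.
  - specialize (T 0%nat).
    replace (if Nat.leb i 0 then 2 * (x i - c i) else 0)
      with (if Nat.eqb 0 i then 2 * (x i - c i) else 0) by (destruct i; reflexivity).
    exact T.
  - pose proof (derivable_pt_lim_plus _ _ _ _ _ IH (T (S N))) as H.
    unfold plus_fct in H.
    match type of H with derivable_pt_lim _ _ ?v => replace (if Nat.leb i (S N) then 2 * (x i - c i) else 0) with v end; [exact H|].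
    destruct (Nat.leb_spec i N), (Nat.leb_spec i (S N)), (Nat.eqb_spec (S N) i); try lia; ring.
Qed.

Lemma derivable_pt_lim_sq (n : nat) (c : nat -> R) (rho : R) (x : nat -> R) (i : nat) :
  (i < n)%nat ->
  derivable_pt_lim (fun t => sq n c rho (upd x i t)) (x i) (2 * (x i - c i)).
Proof.
  intro Hi. unfold sq, nsq.
  replace (2 * (x i - c i)) with (0 + (if Nat.leb i (pred n) then 2 * (x i - c i) else 0)).
  - apply (derivable_pt_lim_plus (fun _ => rho)).
    + apply derivable_pt_lim_const.
    + apply derivable_pt_lim_sum_sq.
  - destruct (Nat.leb_spec i (pred n)); [ring | lia].
Qed.

Lemma derivable_pt_lim_val (n : nat) (c : nat -> R) (rho : R) (e : expr) (x : nat -> R) (i : nat) :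
  (i < n)%nat -> 0 < sq n c rho x ->
  derivable_pt_lim (fun t => val n c rho e (upd x i t)) (x i) (val n c rho (pd i e) x).
Proof.
  intros Hi Hs. pose proof (derivable_pt_lim_sq n c rho x i Hi) as Hsq.
  assert (Hu : sq n c rho (upd x i (x i)) = sq n c rho x) by now rewrite upd_self.
  unfold val; induction e as [a|j|k| |a IHa b IHb|a IHa b IHb]; simpl.
  - apply derivable_pt_lim_const.
  - apply derivable_pt_lim_crd.
  - assert (H : derivable_pt_lim (fun t => / sq n c rho (upd x i t)) (x i)
        (- (2 * (x i - c i)) / Rsqr (sq n c rho x))).
    { apply is_derive_Reals. apply is_derive_Reals in Hsq.
      pose proof (is_derive_inv (fun t => sq n c rho (upd x i t)) (x i) _ Hsq) as H.
      cbv beta in H. rewrite Hu in H. unfold Rsqr.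
      replace (sq n c rho x * sq n c rho x) with (sq n c rho x ^ 2) by ring.
      apply H; lra. }
    pose proof (derivable_pt_lim_comp _ (fun y => y ^ k) _ _ _ H
      (derivable_pt_lim_pow _ k)) as H'.
    unfold comp in H'. rewrite Hu in H'.
    match type of H' with derivable_pt_lim _ _ ?v =>
      match goal with |- derivable_pt_lim _ _ ?w => replace w with v end end; [exact H'|].
    (* The power rule produces [pred k], so k = 0 is separate; there both sides carry the factor
       [INR 0]. *)
    destruct k as [|k]; [simpl; ring|]. unfold Rsqr. simpl pred. simpl pow. field. lra.
  - pose proof (derivable_pt_lim_comp _ ln _ _ _ Hsq
      (derivable_pt_lim_ln (sq n c rho (upd x i (x i))) ltac:(rewrite Hu; exact Hs))) as H.
    unfold comp in H. rewrite Hu in H.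
    apply derivable_pt_lim_opp in H. unfold opp_fct in H.
    match type of H with derivable_pt_lim _ _ ?v =>
      match goal with |- derivable_pt_lim _ _ ?w => replace w with v end end; [exact H|].
    ring.
  - exact (derivable_pt_lim_plus _ _ _ _ _ IHa IHb).
  - pose proof (derivable_pt_lim_mult _ _ _ _ _ IHa IHb) as H.
    cbv beta in H. rewrite upd_self in H. exact H.
Qed.

(* [eval] does not know that s = rho + |z|^2, so identities using this relation only hold
   as identities of functions of x; they can be differentiated by uniqueness of derivatives. *)
Definition eqv (n : nat) (c : nat -> R) (rho : R) (e e' : expr) : Prop :=
  forall x, 0 < sq n c rho x -> val n c rho e x = val n c rho e' x.

(** Positivity of [sq] is an open condition along each coordinate line, so the two functions of t
    agree near [x i] and have the same derivative there. *)
Lemma eqv_pd (n : nat) (c : nat -> R) (rho : R) (e e' : expr) (i : nat) :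
  (i < n)%nat -> eqv n c rho e e' -> eqv n c rho (pd i e) (pd i e').
Proof.
  intros Hi H x Hx.
  apply (uniqueness_limite (fun t => val n c rho e (upd x i t)) (x i)).
  - now apply derivable_pt_lim_val.
  - assert (Hc : continuity_pt (fun t => sq n c rho (upd x i t)) (x i)).
    { apply derivable_continuous_pt. exists (2 * (x i - c i)).
      now apply derivable_pt_lim_sq. }
    (* Taking [sq n c rho x] itself as the tolerance keeps [sq] positive on the whole interval. The
       continuity statement only speaks of t different from [x i], hence the case split below. *)
    destruct (Hc (sq n c rho x) Hx) as [d [Hd Hd']].
    apply (derivable_pt_lim_locally_ext (fun t => val n c rho e' (upd x i t)) _ _
             (x i - d) (x i + d)); [lra| |now apply derivable_pt_lim_val].
    intros t Ht. symmetry. apply H.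
    destruct (Req_dec t (x i)) as [->|Hne]; [now rewrite upd_self|].
    assert (Hlt : Rabs (sq n c rho (upd x i t) - sq n c rho (upd x i (x i))) < sq n c rho x).
    { apply (Hd' t). split; [split; [exact I|auto]|].
      simpl. unfold Rdist. apply Rabs_def1; lra. }
    rewrite upd_self in Hlt. apply Rabs_def2 in Hlt. lra.
Qed.

(** * The Laplacian on expressions and its iterates *)

Fixpoint esum (f : nat -> expr) (N : nat) : expr :=
  match N with
  | O => f O
  | S N' => Add (esum f N') (f (S N'))
  end.

Definition lap (n : nat) (e : expr) : expr := esum (fun i => pd i (pd i e)) (pred n).

Lemma val_esum (n : nat) (c : nat -> R) (rho : R) (f : nat -> expr) (N : nat) (x : nat -> R) :
  val n c rho (esum f N) x = sum_f_R0 (fun i => val n c rho (f i) x) N.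
Proof.
  induction N as [|N IH]; [reflexivity|]. simpl sum_f_R0. rewrite <- IH. reflexivity.
Qed.

Lemma val_lap (n : nat) (c : nat -> R) (rho : R) (e : expr) (x : nat -> R) :
  val n c rho (lap n e) x = sum_f_R0 (fun i => val n c rho (pd i (pd i e)) x) (pred n).
Proof. apply val_esum. Qed.

Lemma eqv_lap (n : nat) (c : nat -> R) (rho : R) (e e' : expr) :
  (0 < n)%nat -> eqv n c rho e e' -> eqv n c rho (lap n e) (lap n e').
Proof.
  intros Hn H x Hx. rewrite !val_lap. apply sum_eq. intros i Hi.
  apply eqv_pd; [lia| |exact Hx]. apply eqv_pd; [lia|exact H].
Qed.

Lemma val_lap_Add (n : nat) (c : nat -> R) (rho : R) (a b : expr) (x : nat -> R) :
  val n c rho (lap n (Add a b)) x = val n c rho (lap n a) x + val n c rho (lap n b) x.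
Proof. rewrite !val_lap, <- sum_plus. reflexivity. Qed.

Lemma val_lap_scal (n : nat) (c : nat -> R) (rho a : R) (e : expr) (x : nat -> R) :
  val n c rho (lap n (Mul (Cst a) e)) x = a * val n c rho (lap n e) x.
Proof.
  rewrite !val_lap, scal_sum. apply sum_eq. intros i _. unfold val; simpl. ring.
Qed.

Lemma val_lap_esum (n : nat) (c : nat -> R) (rho : R) (f : nat -> expr) (N : nat) (x : nat -> R) :
  val n c rho (lap n (esum f N)) x = sum_f_R0 (fun i => val n c rho (lap n (f i)) x) N.
Proof.
  induction N as [|N IH]; [reflexivity|]. simpl esum. rewrite val_lap_Add, IH. reflexivity.
Qed.

Lemma val_iter_lap_esum (n : nat) (c : nat -> R) (rho : R) (k : nat) (f : nat -> expr)
    (N : nat) (x : nat -> R) :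
  (0 < n)%nat -> 0 < sq n c rho x ->
  val n c rho (Nat.iter k (lap n) (esum f N)) x =
  sum_f_R0 (fun i => val n c rho (Nat.iter k (lap n) (f i)) x) N.
Proof.
  intros Hn. revert x. induction k as [|k IH]; intros x Hx; [apply val_esum|].
  simpl Nat.iter.
  rewrite (eqv_lap n c rho _ (esum (fun i => Nat.iter k (lap n) (f i)) N) Hn) by
    (try exact Hx; intros y Hy; rewrite IH, val_esum by exact Hy; reflexivity).
  apply val_lap_esum.
Qed.

(** [lapm] expands the innermost Laplacian first, by prepending [i :: i] to the word. This matches
    [Nat.iter_succ_r], after which linearity moves the remaining k Laplacians inside the sum over
    i. *)
Lemma lapm_val (n : nat) (c : nat -> R) (rho : R) (e : expr) (k : nat) (l : list nat) (x : nat -> R) :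
  (0 < n)%nat -> 0 < sq n c rho x ->
  lapm n (fun l => val n c rho (pds l e)) k l x = val n c rho (Nat.iter k (lap n) (pds l e)) x.
Proof.
  intros Hn Hx. revert l. induction k as [|k IH]; intro l; [reflexivity|].
  simpl lapm. rewrite Nat.iter_succ_r. unfold lap at 2.
  rewrite val_iter_lap_esum by assumption.
  apply sum_eq. intros i _. apply (IH (i :: i :: l)).
Qed.

(** The second derivatives involve z_i^2, whose sum is |z|^2 = s - rho. The s merges with the
    first-order part into the factor m - k - 1, and the rho leaves a term of one higher power of
    1/s. *)
Lemma val_lap_Inv (m k : nat) (c : nat -> R) (rho : R) (x : nat -> R) :
  (0 < m)%nat -> 0 < sq (2 * m) c rho x ->
  val (2 * m) c rho (lap (2 * m) (Inv k)) x =
    -4 * INR k * ((INR m - INR k - 1) * (/ sq (2 * m) c rho x) ^ (S k)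
                  + INR (S k) * rho * (/ sq (2 * m) c rho x) ^ (S (S k))).
Proof.
  intros Hm Hx. rewrite val_lap. unfold val. cbn [pd eval].
  set (s := sq (2 * m) c rho x) in *.
  rewrite (sum_eq _ (fun i => -2 * INR k * (/ s) ^ S k
      + ((x i - c i) ^ 2) * (4 * INR k * INR (S k) * (/ s) ^ S (S k)))).
  2: { intros i _. rewrite Nat.eqb_refl. ring. }
  rewrite sum_plus, sum_cte, <- scal_sum.
  replace (sum_f_R0 (fun i => (x i - c i) ^ 2) (pred (2 * m))) with (s - rho)
    by (unfold s, sq, nsq; ring).
  replace (S (pred (2 * m))) with (2 * m)%nat by lia.
  rewrite mult_INR, (S_INR k). simpl (INR 2). simpl pow. field. lra.
Qed.

(** The computation of [val_lap_Inv] at k = 0 with the prefactor k divided out, since - ln s is the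
    limit of (s^(-k) - 1)/k as k tends to 0. *)
Lemma val_lap_Log (m : nat) (c : nat -> R) (rho : R) (x : nat -> R) :
  (0 < m)%nat -> 0 < sq (2 * m) c rho x ->
  val (2 * m) c rho (lap (2 * m) Log) x =
    -4 * ((INR m - 1) * / sq (2 * m) c rho x + rho * (/ sq (2 * m) c rho x) ^ 2).
Proof.
  intros Hm Hx. rewrite val_lap. unfold val. cbn [pd eval].
  set (s := sq (2 * m) c rho x) in *.
  rewrite (sum_eq _ (fun i => -2 * / s
      + ((x i - c i) ^ 2) * (4 * (/ s) ^ 2))).
  2: { intros i _. rewrite Nat.eqb_refl. simpl. ring. }
  rewrite sum_plus, sum_cte, <- scal_sum.
  replace (sum_f_R0 (fun i => (x i - c i) ^ 2) (pred (2 * m))) with (s - rho)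
    by (unfold s, sq, nsq; ring).
  replace (S (pred (2 * m))) with (2 * m)%nat by lia.
  rewrite mult_INR. simpl (INR 2). simpl pow. field. lra.
Qed.

(** * Coefficients of the iterated Laplacians of the logarithm *)

Fixpoint bin (s i : nat) : R :=
  match s, i with
  | _, O => 1
  | O, S _ => 0
  | S s', S i' => bin s' i' + bin s' (S i')
  end.

Lemma bin_0 (s : nat) : bin s 0 = 1.
Proof. destruct s; reflexivity. Qed.

Lemma bin_absorb (s i : nat) : INR (S i) * bin s (S i) = (INR s - INR i) * bin s i.
Proof.
  revert i; induction s as [|s IH]; intro i.
  - destruct i; simpl; ring.
  - destruct i as [|i].
    + change (bin (S s) 1) with (bin s 0 + bin s 1).
      pose proof (IH 0%nat) as H. rewrite !bin_0 in *. rewrite (S_INR s). simpl INR in *. lra.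
    + change (bin (S s) (S (S i))) with (bin s (S i) + bin s (S (S i))).
      change (bin (S s) (S i)) with (bin s i + bin s (S i)).
      pose proof (IH i) as H1. pose proof (IH (S i)) as H2. rewrite !S_INR in *. nra.
Qed.

Lemma bin_gt (s i : nat) : (s < i)%nat -> bin s i = 0.
Proof.
  revert i; induction s as [|s IH]; intros [|i] H; try lia; [reflexivity|].
  simpl. rewrite !IH by lia. ring.
Qed.

Lemma bin_diag (s : nat) : bin s s = 1.
Proof.
  induction s as [|s IH]; [reflexivity|]. simpl. rewrite IH, bin_gt by lia. ring.
Qed.

(** A segment of a falling factorial: the product (m-1-i)(m-2-i)...(m-s), empty for s <= i. It
    contains the zero factor m - 1 - (m - 1) as soon as i < m <= s. *)
Fixpoint fall (m i s : nat) : R :=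
  match s with
  | O => 1
  | S s' => fall m i s' * (if Nat.leb i s' then INR m - 1 - INR s' else 1)
  end.

Lemma fall_ge (m i s : nat) : (s <= i)%nat -> fall m i s = 1.
Proof.
  induction s as [|s IH]; intro H; [reflexivity|]. simpl.
  destruct (Nat.leb_spec i s); [lia|]. rewrite IH by lia. ring.
Qed.

Lemma fall_step (m i s : nat) : (i < s)%nat -> fall m i s = (INR m - 1 - INR i) * fall m (S i) s.
Proof.
  induction s as [|s IH]; intro H; [lia|]. cbn [fall].
  destruct (Nat.eq_dec i s) as [->|Hne].
  - destruct (Nat.leb_spec s s), (Nat.leb_spec (S s) s); try lia.
    rewrite !fall_ge by lia. ring.
  - destruct (Nat.leb_spec i s), (Nat.leb_spec (S i) s); try lia.
    rewrite IH by lia. ring.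
Qed.

Lemma fall_top (m i : nat) : (i < m)%nat -> fall m i m = 0.
Proof.
  destruct m as [|m]; intro H; [lia|]. cbn [fall].
  destruct (Nat.leb_spec i m); [|lia]. rewrite S_INR. ring.
Qed.

(* [(-4)^(s+1) * lap_coef m s i * rho^i] is the coefficient of 1/(rho + |z|^2)^(s+1+i) in
   Delta^(s+1) (- ln (rho + |z|^2)) on R^(2m); see [iter_lap_Log]. *)
Definition lap_coef (m s i : nat) : R := bin (S s) i * INR (fact (s + i)) * fall m i (S s).

Lemma lap_coef_0 (m s : nat) :
  lap_coef m (S s) 0 = INR (S s) * (INR m - INR (S s) - 1) * lap_coef m s 0.
Proof.
  unfold lap_coef. rewrite !bin_0, !Nat.add_0_r.
  change (fact (S s)) with (S s * fact s)%nat. rewrite mult_INR.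
  change (fall m 0 (S (S s))) with (fall m 0 (S s) * (INR m - 1 - INR (S s))). ring.
Qed.

(** The recursion dictated by [val_lap_Inv]: index i+1 at the next level receives the (m - k - 1)
    part of the term i+1 and the rho part of the term i. Once factorials and the common [fall]
    product are factored out, only binomial identities remain. *)
Lemma lap_coef_S (m s i : nat) : (i <= S s)%nat ->
  lap_coef m (S s) (S i) =
    INR (S s + S i) * (INR m - INR (S s + S i) - 1) * lap_coef m s (S i)
    + INR (S s + i) * INR (S (S s + i)) * lap_coef m s i.
Proof.
  intro H. unfold lap_coef.
  replace (S s + S i)%nat with (S (S (s + i))) by lia.
  replace (s + S i)%nat with (S (s + i)) by lia.
  replace (S s + i)%nat with (S (s + i)) by lia.
  change (fact (S (S (s + i)))) with (S (S (s + i)) * (S (s + i) * fact (s + i)))%nat.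
  change (fact (S (s + i))) with (S (s + i) * fact (s + i))%nat.
  rewrite !mult_INR.
  change (bin (S (S s)) (S i)) with (bin (S s) i + bin (S s) (S i)).
  destruct (Nat.eq_dec i (S s)) as [->|Hne].
  - rewrite bin_diag, bin_gt, !fall_ge by lia. ring.
  - rewrite (fall_step m i (S s)) by lia.
    change (fall m (S i) (S (S s))) with
      (fall m (S i) (S s) * (if Nat.leb (S i) (S s) then INR m - 1 - INR (S s) else 1)).
    destruct (Nat.leb_spec (S i) (S s)); [|lia].
    pose proof (bin_absorb (S s) i) as Hb.
    rewrite !S_INR, plus_INR in *.
    set (F := INR (fact (s + i))). set (P := fall m (S i) (S s)).
    set (b1 := bin (S s) (S i)) in *. set (b0 := bin (S s) i) in *.
    set (a := INR s) in *. set (b := INR i) in *.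
    transitivity (F * P * (a + b + 1 + 1) * (a + b + 1) *
       ((b0 + b1) * (INR m - 1 - (a + 1)))); [ring|].
    (* The sum required by the recursion differs from this by the last summand, which the absorption
       identity [Hb] makes zero. *)
    replace ((b0 + b1) * (INR m - 1 - (a + 1))) with
      (b1 * (INR m - (a + b + 1 + 1) - 1) + b0 * (INR m - 1 - b)
        + ((b + 1) * b1 - (a + 1 - b) * b0)) by ring.
    rewrite Hb. ring.
Qed.

(** Collects like powers when a sum is added to a sum shifted by one index. The test cuts off [a] at
    the new top index, where only [b] contributes. *)
Lemma sum_shift_add (a b : nat -> R) (N : nat) :
  sum_f_R0 a N + sum_f_R0 b N =
  sum_f_R0 (fun i => match i with O => a O | S j => (if Nat.leb i N then a i else 0) + b j end) (S N).
Proof.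
  rewrite (decomp_sum _ (S N)) by lia. cbn [pred].
  rewrite (sum_plus (fun i => if Nat.leb (S i) N then a (S i) else 0) b).
  assert (H : sum_f_R0 a N = a O + sum_f_R0 (fun i => if Nat.leb (S i) N then a (S i) else 0) N).
  { destruct N as [|N]; [simpl; ring|].
    rewrite decomp_sum by lia. simpl pred. rewrite (tech5 _ N).
    destruct (Nat.leb_spec (S (S N)) (S N)); [lia|].
    rewrite Rplus_0_r. f_equal. apply sum_eq. intros i Hi.
    destruct (Nat.leb_spec (S i) (S N)); [reflexivity|lia]. }
  rewrite H. lra.
Qed.

Lemma iter_lap_Log (m s : nat) (c : nat -> R) (rho : R) : (0 < m)%nat ->
  eqv (2 * m) c rho (Nat.iter (S s) (lap (2 * m)) Log)
    (esum (fun i => Mul (Cst ((-4) ^ S s * lap_coef m s i * rho ^ i)) (Inv (S s + i))) (S s)).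
Proof.
  intro Hm. induction s as [|s IH]; intros x Hx.
  - change (Nat.iter 1 (lap (2 * m)) Log) with (lap (2 * m) Log).
    rewrite val_lap_Log by assumption. unfold val, lap_coef; simpl. ring.
  - change (Nat.iter (S (S s)) (lap (2 * m)) Log) with
      (lap (2 * m) (Nat.iter (S s) (lap (2 * m)) Log)).
    rewrite (eqv_lap (2 * m) _ _ _ _ ltac:(lia) IH x Hx), val_lap_esum, val_esum.
    set (q := / sq (2 * m) c rho x).
    (* Each Laplacian splits the term of index i in two: one part keeps the index, the other, with
       an extra rho, moves to i + 1. *)
    rewrite (sum_eq _ (fun i =>
       (-4) ^ S (S s) * lap_coef m s i * rho ^ i * INR (S s + i) * (INR m - INR (S s + i) - 1)
          * q ^ (S (S s) + i)
       + (-4) ^ S (S s) * lap_coef m s i * rho ^ S i * INR (S s + i) * INR (S (S s + i))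
          * q ^ (S (S s) + S i))).
    2: { intros i Hi. rewrite val_lap_scal, val_lap_Inv by assumption. fold q.
         replace (S (S s) + i)%nat with (S (S s + i)) by lia.
         replace (S (S s) + S i)%nat with (S (S (S s + i))) by lia. simpl pow. ring. }
    rewrite sum_plus, sum_shift_add. apply sum_eq. intros [|i] Hi.
    + unfold val; cbn [eval]. fold q. rewrite lap_coef_0, !Nat.add_0_r.
      simpl pow. ring.
    + change (val (2 * m) c rho (Mul (Cst ((-4) ^ S (S s) * lap_coef m (S s) (S i) * rho ^ S i))
         (Inv (S (S s) + S i))) x) with
        ((-4) ^ S (S s) * lap_coef m (S s) (S i) * rho ^ S i * q ^ (S (S s) + S i)).
      rewrite lap_coef_S by lia.
      destruct (Nat.leb_spec (S i) (S s)) as [|Hgt]; [ring|].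
      replace (lap_coef m s (S i)) with 0; [ring|].
      unfold lap_coef. rewrite bin_gt by lia. ring.
Qed.

(* For s + 1 = m all coefficients but the last one vanish. *)
Lemma lapm_Log (m : nat) (c : nat -> R) (rho : R) (x : nat -> R) :
  (0 < m)%nat -> 0 < sq (2 * m) c rho x ->
  lapm (2 * m) (fun l => val (2 * m) c rho (pds l Log)) m nil x =
    (-4) ^ m * INR (fact (2 * m - 1)) * rho ^ m * (/ sq (2 * m) c rho x) ^ (2 * m).
Proof.
  intros Hm Hx. rewrite lapm_val by (assumption || lia). simpl pds.
  destruct m as [|s]; [lia|].
  rewrite (iter_lap_Log _ _ _ _ Hm x Hx), val_esum, tech5.
  rewrite sum_eq_R0.
  - unfold val; cbn [eval]. unfold lap_coef. rewrite bin_diag, fall_ge by lia.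
    replace (2 * S s - 1)%nat with (s + S s)%nat by lia.
    replace (2 * S s)%nat with (S s + S s)%nat by lia. simpl plus. ring.
  - intros i Hi. unfold val; cbn [eval]. unfold lap_coef. rewrite fall_top by lia. ring.
Qed.

(** For rho = 0 a Laplacian turns (1/s)^k into a multiple of (1/s)^(k+1) with factor m - k - 1.
    Starting from k = 1, this factor vanishes at the (m-1)-st Laplacian; the constant dies at the
    first. *)
Lemma lapm_Inv1 (m : nat) (c : nat -> R) (a b : R) (x : nat -> R) :
  (2 <= m)%nat -> 0 < sq (2 * m) c 0 x ->
  lapm (2 * m) (fun l => val (2 * m) c 0 (pds l (Add (Mul (Cst a) (Inv 1)) (Cst b)))) m nil x = 0.
Proof.
  intros Hm Hx. rewrite lapm_val by (assumption || lia). simpl pds.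
  (* The value of the coefficient is irrelevant and left existential; the test records that it is
     zero from m - 1 Laplacians on. *)
  assert (H : forall k, exists a', eqv (2 * m) c 0
     (Nat.iter (S k) (lap (2 * m)) (Add (Mul (Cst a) (Inv 1)) (Cst b)))
     (Mul (Cst (if Nat.leb (S k) (m - 2) then a' else 0)) (Inv (S (S k))))).
  { induction k as [|k [a' IH]].
    - exists (-4 * (INR m - 2) * a). intros y Hy.
      change (Nat.iter 1 (lap (2 * m)) (Add (Mul (Cst a) (Inv 1)) (Cst b))) with
        (lap (2 * m) (Add (Mul (Cst a) (Inv 1)) (Cst b))).
      rewrite val_lap_Add, val_lap_scal, val_lap_Inv by (assumption || lia).
      assert (E : val (2 * m) c 0 (lap (2 * m) (Cst b)) y = 0).
      { rewrite val_lap. apply sum_eq_R0. intros i _. reflexivity. }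
      rewrite E. unfold val; cbn [eval].
      destruct (Nat.leb_spec 1 (m - 2)); [simpl; ring|].
      assert (m = 2)%nat as -> by lia. simpl; ring.
    - exists (-4 * INR (S (S k)) * (INR m - INR (S (S k)) - 1) * a'). intros y Hy.
      change (Nat.iter (S (S k)) (lap (2 * m)) (Add (Mul (Cst a) (Inv 1)) (Cst b))) with
        (lap (2 * m) (Nat.iter (S k) (lap (2 * m)) (Add (Mul (Cst a) (Inv 1)) (Cst b)))).
      rewrite (eqv_lap (2 * m) _ _ _ _ ltac:(lia) IH y Hy).
      rewrite val_lap_scal, val_lap_Inv by (assumption || lia). unfold val; cbn [eval].
      destruct (Nat.leb_spec (S k) (m - 2)), (Nat.leb_spec (S (S k)) (m - 2)); try lia; try ring.
      replace (INR m) with (INR (S (S k)) + 1); [ring|].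
      replace m with (S (S (S k))) by lia. rewrite (S_INR (S (S k))). ring. }
  destruct m as [|m']; [lia|]. destruct (H m') as [a' Ha'].
  rewrite (Ha' x Hx). unfold val; cbn [eval].
  destruct (Nat.leb_spec (S m') (S m' - 2)); [lia|ring].
Qed.

(** * Series of smooth families *)

Definition admissible (b K : R) (z : nat -> R) (s : R) : Prop :=
  (forall i, Rabs (z i) <= K) /\ b <= s <= K.

Lemma Rabs_mult_sub_le (a b a' b' : R) :
  Rabs (a * b - a' * b') <= Rabs a * Rabs (b - b') + Rabs b' * Rabs (a - a').
Proof.
  replace (a * b - a' * b') with (a * (b - b') + b' * (a - a')) by ring.
  rewrite <- !Rabs_mult. apply Rabs_triang.
Qed.

Lemma ln_le_sub_1 (x : R) : 0 < x -> ln x <= x - 1.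
Proof.
  intro Hx. pose proof (exp_ineq1_le (ln x)) as H. rewrite exp_ln in H by assumption. lra.
Qed.

Lemma ln_lip (b s s' : R) : 0 < b -> b <= s -> b <= s' -> Rabs (ln s - ln s') <= / b * Rabs (s - s').
Proof.
  intro Hb.
  assert (H : forall s s', b <= s -> b <= s' -> ln s - ln s' <= / b * Rabs (s - s')).
  { intros t t' Ht Ht'. rewrite <- ln_div by lra.
    eapply Rle_trans; [apply ln_le_sub_1; apply Rdiv_lt_0_compat; lra|].
    replace (t / t' - 1) with (/ t' * (t - t')) by (field; lra).
    assert (0 < / t') by (apply Rinv_0_lt_compat; lra).
    eapply Rle_trans; [apply Rmult_le_compat_l; [lra|apply Rle_abs]|].
    apply Rmult_le_compat_r; [apply Rabs_pos|]. apply Rinv_le_contravar; lra. }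
  intros Hs Hs'. apply Rabs_le. split; [|now apply H].
  pose proof (H s' s Hs' Hs) as H'. rewrite Rabs_minus_sym in H'. lra.
Qed.

Lemma Rinv_lip (b s s' : R) : 0 < b -> b <= s -> b <= s' ->
  Rabs (/ s - / s') <= / b * / b * Rabs (s - s').
Proof.
  intros Hb Hs Hs'. replace (/ s - / s') with (/ s * / s' * (s' - s)) by (field; lra).
  rewrite Rabs_mult, (Rabs_minus_sym s s').
  apply Rmult_le_compat_r; [apply Rabs_pos|].
  assert (0 < / s) by (apply Rinv_0_lt_compat; lra).
  assert (0 < / s') by (apply Rinv_0_lt_compat; lra).
  rewrite Rabs_pos_eq by nra.
  apply Rmult_le_compat; try lra; apply Rinv_le_contravar; lra.
Qed.

Lemma Rinv_pow_bdd (b s : R) (k : nat) : 0 < b -> b <= s -> Rabs ((/ s) ^ k) <= (/ b) ^ k.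
Proof.
  intros Hb Hs.
  assert (0 < / s) by (apply Rinv_0_lt_compat; lra).
  rewrite Rabs_pos_eq by (apply pow_le; lra).
  apply pow_incr. split; [lra|]. apply Rinv_le_contravar; lra.
Qed.

Lemma Rinv_pow_lip (b : R) (k : nat) : 0 < b -> exists C, 0 <= C /\
  forall s s', b <= s -> b <= s' -> Rabs ((/ s) ^ k - (/ s') ^ k) <= C * Rabs (s - s').
Proof.
  intro Hb. assert (Hb' : 0 < / b) by now apply Rinv_0_lt_compat.
  induction k as [|k [C [HC IH]]].
  - exists 0. split; [lra|]. intros s s' _ _. simpl. rewrite Rminus_diag, Rabs_R0. lra.
  - exists (/ b * C + (/ b) ^ k * (/ b * / b)). split.
    { pose proof (pow_le (/ b) k). nra. }
    intros s s' Hs Hs'. simpl pow.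
    eapply Rle_trans; [apply Rabs_mult_sub_le|].
    rewrite Rmult_plus_distr_r. apply Rplus_le_compat.
    + rewrite Rmult_assoc. apply Rmult_le_compat; try apply Rabs_pos; [|now apply IH].
      pose proof (Rinv_pow_bdd b s 1 Hb Hs) as H. now rewrite !pow_1 in H.
    + rewrite (Rmult_assoc ((/ b) ^ k)).
      apply Rmult_le_compat; try apply Rabs_pos; [now apply Rinv_pow_bdd|now apply Rinv_lip].
Qed.

Lemma eval_bdd (e : expr) (b K : R) : 0 < b ->
  exists B, 0 <= B /\ forall z s, admissible b K z s -> Rabs (eval e z s) <= B.
Proof.
  intro Hb. induction e as [a|j|k| |a [A [HA IHa]] a' [B [HB IHb]]|a [A [HA IHa]] a' [B [HB IHb]]].
  - exists (Rabs a). split; [apply Rabs_pos|]. intros; simpl; lra.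
  - exists (Rabs K). split; [apply Rabs_pos|]. intros z s [H _]. simpl.
    eapply Rle_trans; [apply H|apply Rle_abs].
  - exists ((/ b) ^ k). split.
    + apply pow_le. left. now apply Rinv_0_lt_compat.
    + intros z s [_ [H _]]. simpl. now apply Rinv_pow_bdd.
  - exists (Rabs (ln b) + Rabs (ln K)). split.
    { pose proof (Rabs_pos (ln b)); pose proof (Rabs_pos (ln K)); lra. }
    intros z s [_ [H1 H2]]. simpl. rewrite Rabs_Ropp.
    assert (ln b <= ln s) by (apply ln_le; lra).
    assert (ln s <= ln K) by (apply ln_le; lra).
    apply Rabs_le. split_Rabs; lra.
  - exists (A + B). split; [lra|]. intros z s H. simpl.
    eapply Rle_trans; [apply Rabs_triang|]. apply Rplus_le_compat; auto.
  - exists (A * B). split; [nra|]. intros z s H. simpl. rewrite Rabs_mult.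
    apply Rmult_le_compat; auto using Rabs_pos.
Qed.

(** Here z and s are independent variables, so structural induction suffices. The estimate serves
    twice: for the continuity of all derivatives, and for the decay of T_j, which compares one
    expression at two nearby pairs (z, s). *)
Lemma eval_lip (e : expr) (b K : R) : 0 < b ->
  exists C, 0 <= C /\ forall z s z' s' eta,
    admissible b K z s -> admissible b K z' s' ->
    (forall i, Rabs (z i - z' i) <= eta) -> Rabs (s - s') <= eta ->
    Rabs (eval e z s - eval e z' s') <= C * eta.
Proof.
  intro Hb. induction e as [a|j|k| |a [A [HA IHa]] a' [B [HB IHb]]|a [A [HA IHa]] a' [B [HB IHb]]].
  - exists 0. split; [lra|]. intros; simpl. rewrite Rminus_diag, Rabs_R0. lra.
  - exists 1. split; [lra|]. intros z s z' s' eta _ _ H _. simpl. rewrite Rmult_1_l. apply H.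
  - destruct (Rinv_pow_lip b k Hb) as [C [HC H]]. exists C. split; [exact HC|].
    intros z s z' s' eta [_ [H1 _]] [_ [H2 _]] _ Hs. simpl.
    eapply Rle_trans; [now apply H|]. now apply Rmult_le_compat_l.
  - assert (0 < / b) by now apply Rinv_0_lt_compat.
    exists (/ b). split; [lra|].
    intros z s z' s' eta [_ [H1 _]] [_ [H2 _]] _ Hs. simpl.
    replace (- ln s - - ln s') with (- (ln s - ln s')) by ring. rewrite Rabs_Ropp.
    eapply Rle_trans; [apply (ln_lip b s s'); assumption|]. apply Rmult_le_compat_l; lra.
  - exists (A + B). split; [lra|]. intros z s z' s' eta H1 H2 H3 H4. simpl.
    replace (eval a z s + eval a' z s - (eval a z' s' + eval a' z' s'))
      with ((eval a z s - eval a z' s') + (eval a' z s - eval a' z' s')) by ring.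
    eapply Rle_trans; [apply Rabs_triang|]. rewrite Rmult_plus_distr_r.
    apply Rplus_le_compat; auto.
  - destruct (eval_bdd a b K Hb) as [Ma [HMa Ha]].
    destruct (eval_bdd a' b K Hb) as [Mb [HMb Hb']].
    exists (Ma * B + Mb * A). split; [nra|]. intros z s z' s' eta H1 H2 H3 H4. simpl.
    eapply Rle_trans; [apply Rabs_mult_sub_le|].
    rewrite Rmult_plus_distr_r, !Rmult_assoc.
    apply Rplus_le_compat; apply Rmult_le_compat; auto using Rabs_pos.
Qed.

Lemma nsq_pos (n : nat) (x : nat -> R) : 0 <= nsq n x.
Proof. apply cond_pos_sum. intro; apply pow2_ge_0. Qed.

Lemma sum_ge_term (f : nat -> R) (N i : nat) :
  (forall k, 0 <= f k) -> (i <= N)%nat -> f i <= sum_f_R0 f N.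
Proof.
  intros Hf Hi. induction N as [|N IH].
  - replace i with 0%nat by lia. simpl; lra.
  - simpl. destruct (Nat.eq_dec i (S N)) as [->|Hne].
    + pose proof (cond_pos_sum f N Hf). lra.
    + specialize (IH ltac:(lia)). specialize (Hf (S N)). lra.
Qed.

Lemma Rnorm_sqr (n : nat) (x : nat -> R) : Rnorm n x * Rnorm n x = nsq n x.
Proof. apply sqrt_sqrt. apply nsq_pos. Qed.

Lemma Rnorm_pos (n : nat) (x : nat -> R) : 0 <= Rnorm n x.
Proof. apply sqrt_pos. Qed.

Lemma Rabs_le_Rnorm (n : nat) (x : nat -> R) (i : nat) :
  inRn n x -> Rabs (x i) <= Rnorm n x.
Proof.
  intro Hx. destruct (Nat.le_gt_cases n i) as [H|H].
  - rewrite Hx by assumption. rewrite Rabs_R0. apply Rnorm_pos.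
  - rewrite <- (Rabs_pos_eq (Rnorm n x)) by apply Rnorm_pos.
    apply Rsqr_le_abs_0. unfold Rsqr. rewrite Rnorm_sqr.
    pose proof (sum_ge_term (fun i => x i ^ 2) (pred n) i (fun k => pow2_ge_0 _) ltac:(lia)) as H'.
    unfold nsq. cbv beta in H'. lra.
Qed.

Lemma inRn_sub (n : nat) (x y : nat -> R) : inRn n x -> inRn n y -> inRn n (fun j => y j - x j).
Proof. intros Hx Hy i Hi. rewrite Hx, Hy by assumption. ring. Qed.

Lemma nsq_lip (n : nat) (z z' : nat -> R) (K d : R) : (0 < n)%nat ->
  (forall i, Rabs (z i) <= K) -> (forall i, Rabs (z' i) <= K) ->
  (forall i, Rabs (z i - z' i) <= d) ->
  Rabs (nsq n z - nsq n z') <= INR n * (2 * K) * d.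
Proof.
  intros Hn Hz Hz' Hd. unfold nsq. rewrite <- minus_sum.
  eapply Rle_trans; [apply Rsum_abs|].
  apply Rle_trans with (sum_f_R0 (fun _ => 2 * K * d) (pred n)).
  - apply sum_Rle. intros i _.
    replace (z i ^ 2 - z' i ^ 2) with ((z i + z' i) * (z i - z' i)) by ring.
    rewrite Rabs_mult. apply Rmult_le_compat; try apply Rabs_pos; [|apply Hd].
    eapply Rle_trans; [apply Rabs_triang|]. specialize (Hz i); specialize (Hz' i); lra.
  - rewrite sum_cte. replace (S (pred n)) with n by lia. lra.
Qed.

(** * Smooth families: linear combinations and expressions *)

Lemma smooth_family_lin (n : nat) (U : (nat -> R) -> Prop)
    (D1 D2 : list nat -> (nat -> R) -> R) (a b : R) :
  smooth_family n U D1 -> smooth_family n U D2 ->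
  smooth_family n U (fun l x => a * D1 l x + b * D2 l x).
Proof.
  intros [H1 C1] [H2 C2]. split.
  - intros l i x Hi Hx.
    exact (derivable_pt_lim_plus _ _ _ _ _
      (derivable_pt_lim_scal _ a _ _ (H1 l i x Hi Hx))
      (derivable_pt_lim_scal _ b _ _ (H2 l i x Hi Hx))).
  - intros l x Hx eps Heps.
    set (M := Rabs a + Rabs b + 1).
    assert (HM : 0 < M) by (unfold M; pose proof (Rabs_pos a); pose proof (Rabs_pos b); lra).
    assert (He : 0 < eps / M) by (apply Rdiv_lt_0_compat; lra).
    destruct (C1 l x Hx _ He) as [d1 [Hd1 K1]], (C2 l x Hx _ He) as [d2 [Hd2 K2]].
    exists (Rmin d1 d2). split; [now apply Rmin_pos|].
    intros y Hy HU Hd.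
    specialize (K1 y Hy HU (Rlt_le_trans _ _ _ Hd (Rmin_l _ _))).
    specialize (K2 y Hy HU (Rlt_le_trans _ _ _ Hd (Rmin_r _ _))).
    replace (a * D1 l y + b * D2 l y - (a * D1 l x + b * D2 l x))
      with (a * (D1 l y - D1 l x) + b * (D2 l y - D2 l x)) by ring.
    eapply Rle_lt_trans; [apply Rabs_triang|]. rewrite !Rabs_mult.
    apply Rle_lt_trans with ((Rabs a + Rabs b) * (eps / M)).
    + rewrite Rmult_plus_distr_r.
      apply Rplus_le_compat; apply Rmult_le_compat_l; auto using Rabs_pos, Rlt_le.
    + replace eps with (M * (eps / M)) at 2 by (field; lra).
      apply Rmult_lt_compat_r; [assumption|]. unfold M; lra.
Qed.

Lemma smooth_family_val (n : nat) (U : (nat -> R) -> Prop) (c : nat -> R) (rho : R) (e : expr) :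
  (0 < n)%nat -> inRn n c -> (forall x, U x -> inRn n x /\ 0 < sq n c rho x) ->
  smooth_family n U (fun l => val n c rho (pds l e)).
Proof.
  intros Hn Hc HU. split.
  - intros l i x Hi Hx. apply (derivable_pt_lim_val n c rho (pds l e)); [exact Hi|now apply HU].
  - intros l x Hx eps Heps. destruct (HU x Hx) as [Hx0 Hs].
    set (s := sq n c rho x) in *.
    pose proof (Rnorm_pos n (fun k => x k - c k)) as Hr.
    set (r := Rnorm n (fun k => x k - c k)) in *.
    set (M := INR n * (2 * (r + 1)) + 1).
    assert (HM : 1 <= M).
    { unfold M. pose proof (pos_INR n). nra. }
    set (K := r + 1 + s * 2).
    destruct (eval_lip (pds l e) (s / 2) K ltac:(lra)) as [C [HC HL]].
    (* [M] bounds the Lipschitz constant of [sq] on the unit ball around x. The three radii keep y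
       in that ball, keep [sq] at y above s/2, and make the resulting error C M d smaller than
       eps. *)
    exists (Rmin 1 (Rmin (s / (2 * M)) (eps / (C * M + 1)))).
    assert (HCM : 0 <= C * M) by nra.
    assert (Hp1 : 0 < s / (2 * M)) by (apply Rdiv_lt_0_compat; lra).
    assert (Hp2 : 0 < eps / (C * M + 1)) by (apply Rdiv_lt_0_compat; lra).
    split; [repeat apply Rmin_pos; lra|].
    intros y Hy _ Hd. pose proof (Rnorm_pos n (fun j => y j - x j)) as Hd0.
    assert (Hdi : forall i, Rabs (y i - x i) <= Rnorm n (fun j => y j - x j)).
    { intro i. apply (Rabs_le_Rnorm n (fun j => y j - x j)). now apply inRn_sub. }
    set (d := Rnorm n (fun j => y j - x j)) in *.
    assert (Hd1 : d < 1) by (eapply Rlt_le_trans; [exact Hd|apply Rmin_l]).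
    assert (Hd2 : d < s / (2 * M)).
    { eapply Rlt_le_trans; [exact Hd|]. eapply Rle_trans; [apply Rmin_r|apply Rmin_l]. }
    assert (Hd3 : d < eps / (C * M + 1)).
    { eapply Rlt_le_trans; [exact Hd|]. eapply Rle_trans; [apply Rmin_r|apply Rmin_r]. }
    assert (Hzx : forall i, Rabs (x i - c i) <= r).
    { intro i. apply (Rabs_le_Rnorm n (fun k => x k - c k)). now apply inRn_sub. }
    assert (Hzd : forall i, Rabs ((y i - c i) - (x i - c i)) <= d).
    { intro i. replace (y i - c i - (x i - c i)) with (y i - x i) by ring. apply Hdi. }
    assert (Hzy : forall i, Rabs (y i - c i) <= r + 1).
    { intro i. specialize (Hzx i). specialize (Hzd i). split_Rabs; lra. }
    assert (Hsy : Rabs (sq n c rho y - s) <= M * d).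
    { unfold s, sq. replace (rho + nsq n (fun k => y k - c k) - (rho + nsq n (fun k => x k - c k)))
        with (nsq n (fun k => y k - c k) - nsq n (fun k => x k - c k)) by ring.
      eapply Rle_trans; [apply (nsq_lip n _ _ (r + 1) d Hn Hzy)|].
      - intro i. specialize (Hzx i). lra.
      - exact Hzd.
      - unfold M. nra. }
    assert (HMd : M * d <= s / 2).
    { replace (s / 2) with (M * (s / (2 * M))) by (field; lra). apply Rmult_le_compat_l; lra. }
    apply Rle_lt_trans with (C * (M * d)).
    + apply HL.
      * split; [intro i; specialize (Hzy i); unfold K; lra|].
        unfold K. split_Rabs; lra.
      * split; [intro i; specialize (Hzx i); unfold K; lra|]. fold s. unfold K. lra.
      * intro i. specialize (Hzd i). nra.
      * exact Hsy.
    + apply Rle_lt_trans with ((C * M + 1) * d); [nra|].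
      replace eps with ((C * M + 1) * (eps / (C * M + 1))) by (field; lra).
      apply Rmult_lt_compat_l; lra.
Qed.

(** * Series with geometric majorants and termwise differentiation *)

Lemma series_tail (a : nat -> R) (C : R) (J : nat) :
  (forall j, (J <= j)%nat -> Rabs (a j) <= C * (/ 2) ^ j) ->
  ex_series a /\ forall N, (J <= N)%nat -> Rabs (Series a - sum_f_R0 a N) <= C * (/ 2) ^ N.
Proof.
  intro H.
  assert (Hg : Rabs (/ 2) < 1) by (rewrite Rabs_pos_eq; lra).
  assert (Hgk : forall N, is_series (fun k => C * (/ 2) ^ (N + k)) (C * (/ 2) ^ N * 2)).
  { intro N.
    replace (C * (/ 2) ^ N * 2) with (scal (C * (/ 2) ^ N) (/ (1 - / 2)))
      by (unfold scal; simpl; unfold mult; simpl; field; lra).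
    apply is_series_ext with (fun k => scal (C * (/ 2) ^ N) ((/ 2) ^ k)).
    - intro k. unfold scal; simpl; unfold mult; simpl. rewrite pow_add. ring.
    - apply (is_series_scal (V := R_NormedModule)). now apply is_series_geom. }
  assert (HE : forall N, (J <= N)%nat -> ex_series (fun k => Rabs (a (N + k)%nat))).
  { intros N HN. apply (ex_series_le (V := R_CompleteNormedModule) _ (fun k => C * (/ 2) ^ (N + k))).
    - intro k. unfold norm; simpl; unfold abs; simpl. rewrite Rabs_Rabsolu. apply H. lia.
    - eexists; apply Hgk. }
  assert (Ha : ex_series a).
  { apply (ex_series_incr_n a J). apply ex_series_Rabs. now apply HE. }
  split; [exact Ha|]. intros N HN.
  (* The remainder starts at index N + 1, where the geometric majorant sums to exactly C 2^(-N). *)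
  rewrite (Series_incr_n a (S N)) by (lia || exact Ha). simpl pred.
  replace (sum_f_R0 a N + Series (fun k => a (S N + k)%nat) - sum_f_R0 a N)
    with (Series (fun k => a (S N + k)%nat)) by ring.
  eapply Rle_trans; [apply Series_Rabs; apply HE; lia|].
  apply Rle_trans with (Series (fun k => C * (/ 2) ^ (S N + k))).
  - apply Series_le.
    + intro k. split; [apply Rabs_pos|]. apply H. lia.
    + eexists; apply Hgk.
  - rewrite (is_series_unique _ _ (Hgk (S N))). simpl pow. lra.
Qed.

Lemma pow_half_small (C eps : R) : 0 < eps -> exists N0, forall N, (N0 <= N)%nat -> C * (/ 2) ^ N < eps.
Proof.
  intro He.
  destruct (pow_lt_1_zero (/ 2) ltac:(rewrite Rabs_pos_eq; lra) (eps / (Rabs C + 1))) as [N0 H].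
  { apply Rdiv_lt_0_compat; [lra|]. pose proof (Rabs_pos C); lra. }
  exists N0. intros N HN. specialize (H N HN).
  assert (Hp : 0 < (/ 2) ^ N) by (apply pow_lt; lra).
  rewrite Rabs_pos_eq in H by lra.
  pose proof (Rabs_pos C).
  apply Rle_lt_trans with ((Rabs C + 1) * (/ 2) ^ N).
  - apply Rmult_le_compat_r; [lra|]. pose proof (Rle_abs C). lra.
  - replace eps with ((Rabs C + 1) * (eps / (Rabs C + 1))) by (field; lra).
    apply Rmult_lt_compat_l; lra.
Qed.

Lemma derivable_pt_lim_sum (f f' : nat -> R -> R) (N : nat) (t : R) :
  (forall j, derivable_pt_lim (f j) t (f' j t)) ->
  derivable_pt_lim (fun u => sum_f_R0 (fun j => f j u) N) t (sum_f_R0 (fun j => f' j t) N).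
Proof.
  intro H. induction N as [|N IH]; simpl; [apply H|].
  exact (derivable_pt_lim_plus _ _ _ _ _ IH (H (S N))).
Qed.

Lemma upd_upd (x : nat -> R) (i : nat) (t t' : R) : upd (upd x i t) i t' = upd x i t'.
Proof.
  apply functional_extensionality; intro j; unfold upd. now destruct (Nat.eqb j i).
Qed.

Lemma upd_eq (x : nat -> R) (i : nat) (t : R) : upd x i t i = t.
Proof. unfold upd. now rewrite Nat.eqb_refl. Qed.

Lemma inRn_upd (n : nat) (x : nat -> R) (i : nat) (t : R) :
  (i < n)%nat -> inRn n x -> inRn n (upd x i t).
Proof.
  intros Hi Hx j Hj. unfold upd. destruct (Nat.eqb_spec j i); [lia|]. now apply Hx.
Qed.

Lemma sum_single (i N : nat) (v : R) :
  sum_f_R0 (fun j => if Nat.eqb j i then v else 0) N = if Nat.leb i N then v else 0.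
Proof.
  induction N as [|N IH]; [destruct i; reflexivity|]. rewrite tech5, IH.
  destruct (Nat.leb_spec i N), (Nat.leb_spec i (S N)), (Nat.eqb_spec (S N) i); try lia; ring.
Qed.

Lemma Rnorm_upd (n : nat) (x : nat -> R) (i : nat) (t : R) : (i < n)%nat ->
  Rnorm n (fun j => upd x i t j - x j) = Rabs (t - x i).
Proof.
  intro Hi. rewrite <- sqrt_Rsqr_abs. unfold Rnorm. f_equal.
  rewrite (sum_eq _ (fun j => if Nat.eqb j i then Rsqr (t - x i) else 0)).
  - rewrite sum_single. destruct (Nat.leb_spec i (pred n)); [reflexivity|lia].
  - intros j _. unfold upd, Rsqr. destruct (Nat.eqb_spec j i); subst; ring.
Qed.

Lemma Rnorm_self (n : nat) (x : nat -> R) : Rnorm n (fun j => x j - x j) = 0.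
Proof.
  unfold Rnorm. rewrite sum_eq_R0; [apply sqrt_0|]. intros j _. ring.
Qed.

Lemma smooth_family_sum (n : nat) (U : (nat -> R) -> Prop)
    (F : list nat -> nat -> (nat -> R) -> R) (N : nat) :
  (forall j, smooth_family n U (fun l => F l j)) ->
  smooth_family n U (fun l x => sum_f_R0 (fun j => F l j x) N).
Proof.
  intro H. induction N as [|N IH]; [apply (H 0%nat)|].
  pose proof (smooth_family_lin n U _ _ 1 1 IH (H (S N))) as H'.
  replace (fun l x => sum_f_R0 (fun j => F l j x) (S N)) with
    (fun l x => 1 * sum_f_R0 (fun j => F l j x) N + 1 * F l (S N) x); [exact H'|].
  apply functional_extensionality; intro l; apply functional_extensionality; intro x.
  simpl; ring.
Qed.

(** The local geometric bounds hold for every word l, so each derivative series converges locally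
    uniformly. Differentiation is then termwise along coordinate lines, and continuity follows by an
    eps/3 argument. *)
Lemma smooth_family_Series (n : nat) (U : (nat -> R) -> Prop)
    (F : list nat -> nat -> (nat -> R) -> R) :
  (forall x, U x -> inRn n x) ->
  (forall x, U x -> exists r, 0 < r /\
     forall y, inRn n y -> Rnorm n (fun j => y j - x j) < r -> U y) ->
  (forall j, smooth_family n U (fun l => F l j)) ->
  (forall l x, U x -> exists r C J, 0 < r /\ forall j y, (J <= j)%nat ->
     inRn n y -> U y -> Rnorm n (fun k => y k - x k) < r -> Rabs (F l j y) <= C * (/ 2) ^ j) ->
  smooth_family n U (fun l x => Series (fun j => F l j x)).
Proof.
  intros HR HO HF HB. split.
  - intros l i x Hi Hx. pose proof (HR x Hx) as Hx0.
    destruct (HO x Hx) as [r0 [Hr0 H0]].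
    destruct (HB l x Hx) as [r1 [C1 [J1 [Hr1 H1]]]].
    destruct (HB (i :: l) x Hx) as [r2 [C2 [J2 [Hr2 H2]]]].
    assert (Hr : 0 < Rmin r0 (Rmin r1 r2)) by (repeat apply Rmin_pos; assumption).
    set (r := mkposreal _ Hr).
    assert (Hin : forall t, Boule (x i) r t -> inRn n (upd x i t) /\ U (upd x i t) /\
       Rnorm n (fun j => upd x i t j - x j) < r1 /\ Rnorm n (fun j => upd x i t j - x j) < r2).
    { intros t Ht. unfold Boule in Ht. simpl in Ht.
      rewrite Rnorm_upd by assumption.
      pose proof (Rmin_l r0 (Rmin r1 r2)); pose proof (Rmin_r r0 (Rmin r1 r2)).
      pose proof (Rmin_l r1 r2); pose proof (Rmin_r r1 r2).
      assert (inRn n (upd x i t)) by now apply inRn_upd.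
      repeat split; try lra; [assumption|]. apply H0; [assumption|].
      rewrite Rnorm_upd by assumption. lra. }
    assert (HD : forall t j l', Boule (x i) r t ->
      derivable_pt_lim (fun u => F l' j (upd x i u)) t (F (i :: l') j (upd x i t))).
    { intros t j l' Ht. destruct (Hin t Ht) as [_ [HU _]].
      pose proof (proj1 (HF j) l' i _ Hi HU) as H. cbv beta in H. rewrite upd_eq in H.
      replace (fun u => F l' j (upd x i u)) with (fun u => F l' j (upd (upd x i t) i u));
        [exact H|].
      apply functional_extensionality; intro u. now rewrite upd_upd. }
    assert (HCV : CVU (fun N t => sum_f_R0 (fun j => F (i :: l) j (upd x i t)) N)
              (fun t => Series (fun j => F (i :: l) j (upd x i t))) (x i) r).
    { intros eps Heps. destruct (pow_half_small C2 eps Heps) as [N0 HN0].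
      exists (max J2 N0). intros N t HN Ht. destruct (Hin t Ht) as [Ha [Hb [Hc Hd]]].
      eapply Rle_lt_trans; [|apply (HN0 N); lia].
      apply (series_tail _ C2 J2); [|lia]. intros j Hj. now apply H2. }
    assert (Hxr : Boule (x i) r (x i)).
    { unfold Boule. rewrite Rminus_diag, Rabs_R0. apply cond_pos. }
    pose proof (derivable_pt_lim_CVU
      (fun N t => sum_f_R0 (fun j => F l j (upd x i t)) N)
      (fun N t => sum_f_R0 (fun j => F (i :: l) j (upd x i t)) N)
      (fun t => Series (fun j => F l j (upd x i t)))
      (fun t => Series (fun j => F (i :: l) j (upd x i t))) (x i) (x i) r Hxr) as HH.
    cbv beta in HH. rewrite upd_self in HH. apply HH; clear HH.
    + intros t N Ht.
      apply (derivable_pt_lim_sum (fun j u => F l j (upd x i u))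
        (fun j u => F (i :: l) j (upd x i u))). intro j. now apply HD.
    + intros t Ht eps Heps. destruct (pow_half_small C1 eps Heps) as [N0 HN0].
      exists (max J1 N0). intros N HN. destruct (Hin t Ht) as [Ha [Hb [Hc Hd]]].
      unfold Rdist. rewrite Rabs_minus_sym.
      eapply Rle_lt_trans; [|apply (HN0 N); lia].
      apply (series_tail _ C1 J1); [|lia]. intros j Hj. now apply H1.
    + exact HCV.
    (* The limit of the derivatives must be continuous; the partial sums are, being differentiable
       through the next derivative [i :: i :: l]. *)
    + apply (CVU_continuity _ _ _ _ HCV). intros N t Ht.
      apply derivable_continuous_pt.
      exists (sum_f_R0 (fun j => F (i :: i :: l) j (upd x i t)) N).
      apply (derivable_pt_lim_sum (fun j u => F (i :: l) j (upd x i u))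
        (fun j u => F (i :: i :: l) j (upd x i u))). intro j. now apply HD.
  - intros l x Hx eps Heps. pose proof (HR x Hx) as Hx0.
    destruct (HB l x Hx) as [r [C [J [Hr H]]]].
    destruct (pow_half_small C (eps / 3) ltac:(lra)) as [N0 HN0].
    set (N := max J N0).
    destruct (proj2 (smooth_family_sum n U F N HF) l x Hx (eps / 3) ltac:(lra)) as [d [Hd HdN]].
    exists (Rmin r d). split; [now apply Rmin_pos|]. intros y Hy HU Hyx.
    specialize (HdN y Hy HU (Rlt_le_trans _ _ _ Hyx (Rmin_r _ _))).
    assert (HT : forall z, inRn n z -> U z -> Rnorm n (fun k => z k - x k) < r ->
      Rabs (Series (fun j => F l j z) - sum_f_R0 (fun j => F l j z) N) < eps / 3).
    { intros z Hz HUz Hzr. eapply Rle_lt_trans; [|apply (HN0 N); unfold N; lia].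
      apply (series_tail _ C J); [|unfold N; lia]. intros j Hj. now apply H. }
    pose proof (HT y Hy HU (Rlt_le_trans _ _ _ Hyx (Rmin_l _ _))) as T1.
    pose proof (HT x Hx0 Hx ltac:(rewrite Rnorm_self; exact Hr)) as T2.
    cbv beta in HdN.
    apply Rabs_def2 in T1; apply Rabs_def2 in T2; apply Rabs_def2 in HdN. apply Rabs_def1; lra.
Qed.

Lemma lapm_lin (n : nat) (D1 D2 : list nat -> (nat -> R) -> R) (a b : R) (k : nat)
    (l : list nat) (x : nat -> R) :
  lapm n (fun l x => a * D1 l x + b * D2 l x) k l x = a * lapm n D1 k l x + b * lapm n D2 k l x.
Proof.
  revert l; induction k as [|k IH]; intro l; [reflexivity|]. simpl.
  rewrite !scal_sum, <- sum_plus. apply sum_eq. intros i _. rewrite IH. ring.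
Qed.

Lemma ex_series_sum (f : nat -> nat -> R) (N : nat) :
  (forall i, ex_series (f i)) ->
  ex_series (fun j => sum_f_R0 (fun i => f i j) N) /\
  Series (fun j => sum_f_R0 (fun i => f i j) N) = sum_f_R0 (fun i => Series (f i)) N.
Proof.
  intro H. induction N as [|N [IH1 IH2]]; [split; [apply (H 0%nat)|reflexivity]|].
  split; simpl.
  - now apply (ex_series_plus (V := R_NormedModule)).
  - rewrite Series_plus by auto. now rewrite IH2.
Qed.

(** [lapm] is a finite sum of members of the family at the single point x, so the exchange is only
    additivity of convergent series. *)
Lemma lapm_Series (n : nat) (F : list nat -> nat -> (nat -> R) -> R) (k : nat)
    (l : list nat) (x : nat -> R) :
  (forall l, ex_series (fun j => F l j x)) ->
  ex_series (fun j => lapm n (fun l => F l j) k l x) /\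
  lapm n (fun l x => Series (fun j => F l j x)) k l x =
    Series (fun j => lapm n (fun l => F l j) k l x).
Proof.
  intro H. revert l; induction k as [|k IH]; intro l; [split; [apply H|reflexivity]|].
  simpl. destruct (ex_series_sum (fun i j => lapm n (fun l => F l j) k (i :: i :: l) x) (pred n))
    as [E1 E2]; [intro i; apply IH|].
  split; [exact E1|]. rewrite E2. apply sum_eq. intros i _. apply IH.
Qed.

(** * The solution *)

Definition origin : nat -> R := fun _ => 0.

Definition axis (t : R) : nat -> R := fun k => if Nat.eqb k 0 then t else 0.

(** The shifted exponent makes the sequence sum to 1 and keeps it inside (0,1), where phi is
    positive. *)
Definition tau (j : nat) : R := (/ 2) ^ S j.

(* The derivative of T_j along the word l. *)
Definition bubble (n : nat) (rho : nat -> R) (l : list nat) (j : nat) (x : nat -> R) : R :=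
  1 * val n (axis (tau j)) (rho j) (pds l Log) x + -1 * val n origin 0 (pds l Log) x.

Lemma sq_origin (n : nat) (x : nat -> R) : sq n origin 0 x = nsq n x.
Proof.
  unfold sq, nsq, origin. rewrite Rplus_0_l. apply sum_eq. intros i _. ring.
Qed.

Lemma sq_axis (n : nat) (t rho : R) (x : nat -> R) :
  sq n (axis t) rho x = rho + nsq n x - 2 * t * x 0%nat + t ^ 2.
Proof.
  unfold sq, nsq.
  rewrite (sum_eq _ (fun k => x k ^ 2 + (if Nat.eqb k 0 then t ^ 2 - 2 * t * x 0%nat else 0))).
  - rewrite sum_plus, sum_single. simpl. ring.
  - intros i _. unfold axis. destruct (Nat.eqb_spec i 0); subst; ring.
Qed.

Lemma inRn_axis (n : nat) (t : R) : (0 < n)%nat -> inRn n (axis t).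
Proof. intros Hn i Hi. unfold axis. destruct (Nat.eqb_spec i 0); [lia|reflexivity]. Qed.

Lemma nsq_axis (n : nat) (t : R) : nsq n (axis t) = t ^ 2.
Proof.
  unfold nsq. rewrite (sum_eq _ (fun k => if Nat.eqb k 0 then t ^ 2 else 0)).
  - rewrite sum_single. reflexivity.
  - intros i _. unfold axis. destruct (Nat.eqb i 0); ring.
Qed.

Lemma tau_pos (j : nat) : 0 < tau j <= / 2.
Proof.
  unfold tau. split; [apply pow_lt; lra|]. simpl pow.
  pose proof (pow_le (/ 2) j ltac:(lra)).
  assert ((/ 2) ^ j <= 1); [|lra].
  rewrite <- (pow1 j). apply pow_incr. lra.
Qed.

(** The right side minus the left is |2y - x|^2. This replaces the triangle inequality for
    [Rnorm]. *)
Lemma nsq_par (n : nat) (x y : nat -> R) :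
  nsq n x <= 2 * nsq n y + 2 * nsq n (fun k => y k - x k).
Proof.
  unfold nsq. rewrite !scal_sum, <- sum_plus. apply sum_Rle. intros i _.
  assert (0 <= (2 * y i - x i) ^ 2) by apply pow2_ge_0. nra.
Qed.

Lemma nsq_neg (n : nat) (x y : nat -> R) : nsq n (fun k => y k - x k) = nsq n (fun k => x k - y k).
Proof. unfold nsq. apply sum_eq. intros i _. ring. Qed.

Lemma punctured_pos (n : nat) (x : nat -> R) : punctured n x -> 0 < Rnorm n x.
Proof. intros [_ H]. pose proof (Rnorm_pos n x). lra. Qed.

Lemma punctured_nsq (n : nat) (x : nat -> R) : punctured n x -> 0 < nsq n x.
Proof. intros H%punctured_pos. rewrite <- Rnorm_sqr. nra. Qed.

Lemma sq_axis_pos (n : nat) (t rho : R) (x : nat -> R) : 0 < rho -> 0 < sq n (axis t) rho x.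
Proof. intro H. unfold sq. pose proof (nsq_pos n (fun k => x k - axis t k)). lra. Qed.

Lemma sq_axis_near (n : nat) (j : nat) (rho K : R) (x : nat -> R) :
  inRn n x -> 0 < rho <= tau j ^ 2 -> Rnorm n x <= K ->
  Rabs (sq n (axis (tau j)) rho x - nsq n x) <= (2 + 2 * K) * tau j.
Proof.
  intros Hx Hr HK. rewrite sq_axis.
  pose proof (Rabs_le_Rnorm n x 0 Hx) as H0. pose proof (tau_pos j) as [Ht1 Ht2].
  set (t := tau j) in *. apply Rabs_le.
  assert (- K <= x 0%nat <= K) by (split_Rabs; lra).
  assert (t * t <= t) by nra.
  split; simpl in Hr |- *; nra.
Qed.

(** Both terms of [bubble] evaluate the same expression, at (x - c_j, rho_j + |x - c_j|^2) and at
    (x, |x|^2). These pairs differ by O(tau_j), and [eval_lip] transfers this to the values. *)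
Lemma bubble_bdd (n : nat) (rho : nat -> R) (l : list nat) (b K : R) :
  (0 < n)%nat -> (forall j, 0 < rho j <= tau j ^ 2) -> 0 < b -> 0 <= K ->
  exists C J, forall j y, (J <= j)%nat -> inRn n y -> b <= nsq n y <= K ^ 2 ->
    Rabs (bubble n rho l j y) <= C * (/ 2) ^ j.
Proof.
  intros Hn Hrho Hb HK.
  (* The upper constant covers the shifted coordinates, at most K + 1, and the perturbed s, at most
     K^2 + b/2; [J] is taken so large that s stays above b/2. *)
  destruct (eval_lip (pds l Log) (b / 2) (K + 1 + K ^ 2 + b) ltac:(lra)) as [C [HC HL]].
  destruct (pow_half_small (2 + 2 * K) (b / 2) ltac:(lra)) as [J HJ].
  exists (C * (2 + 2 * K)), J. intros j y Hj Hy [Hb1 Hb2].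
  specialize (HJ j Hj).
  pose proof (tau_pos j) as [Ht1 Ht2].
  assert (Htj : tau j = / 2 * (/ 2) ^ j) by reflexivity.
  assert (HR : Rnorm n y <= K).
  { pose proof (Rnorm_sqr n y). pose proof (Rnorm_pos n y). simpl in Hb2. nra. }
  pose proof (sq_axis_near n j (rho j) K y Hy (Hrho j) HR) as Hs.
  assert (Hs' : Rabs (sq n (axis (tau j)) (rho j) y - nsq n y) <= (2 + 2 * K) * (/ 2) ^ j).
  { eapply Rle_trans; [exact Hs|]. apply Rmult_le_compat_l; lra. }
  assert (Hyk : forall k, Rabs (y k) <= K).
  { intro k. eapply Rle_trans; [now apply (Rabs_le_Rnorm n)|exact HR]. }
  assert (Hax : forall k, Rabs (axis (tau j) k) <= tau j).
  { intro k. unfold axis. destruct (Nat.eqb k 0); [rewrite Rabs_pos_eq|rewrite Rabs_R0]; lra. }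
  pose proof (pow2_ge_0 K) as HK2.
  rewrite Rmult_assoc. unfold bubble, val.
  match goal with |- Rabs (1 * ?a + -1 * ?b) <= _ => replace (1 * a + -1 * b) with (a - b) by ring end.
  apply HL.
  - split.
    + intro k. specialize (Hyk k). specialize (Hax k). split_Rabs; lra.
    + split_Rabs; lra.
  - rewrite sq_origin. split; [|lra].
    intro k. unfold origin. rewrite Rminus_0_r. specialize (Hyk k). lra.
  - intro k. unfold origin.
    replace (y k - axis (tau j) k - (y k - 0)) with (- axis (tau j) k) by ring.
    rewrite Rabs_Ropp. eapply Rle_trans; [apply Hax|]. nra.
  - rewrite sq_origin. exact Hs'.
Qed.

Lemma bubble_loc_bdd (n : nat) (rho : nat -> R) (l : list nat) (x : nat -> R) :
  (0 < n)%nat -> (forall j, 0 < rho j <= tau j ^ 2) -> punctured n x ->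
  exists r C J, 0 < r /\ forall j y, (J <= j)%nat -> inRn n y ->
    punctured n y -> Rnorm n (fun k => y k - x k) < r ->
    Rabs (bubble n rho l j y) <= C * (/ 2) ^ j.
Proof.
  intros Hn Hrho Hx. pose proof (punctured_pos n x Hx) as HR.
  (* For |y - x| < |x|/2, [nsq_par] used in both directions gives |x|^2/4 <= |y|^2 <= 4|x|^2. *)
  destruct (bubble_bdd n rho l (Rnorm n x ^ 2 / 4) (2 * Rnorm n x) Hn Hrho) as [C [J H]];
    [simpl; nra|lra|].
  exists (Rnorm n x / 2), C, J. split; [lra|]. intros j y Hj Hy _ Hd. apply H; [assumption..|].
  pose proof (Rnorm_pos n (fun k => y k - x k)) as Hd0.
  pose proof (nsq_par n x y) as P1. pose proof (nsq_par n y x) as P2.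
  rewrite <- nsq_neg in P2. rewrite <- !Rnorm_sqr in *.
  set (d := Rnorm n (fun k => y k - x k)) in *. simpl. nra.
Qed.

Lemma ex_series_bubble (n : nat) (rho : nat -> R) (l : list nat) (x : nat -> R) :
  (0 < n)%nat -> (forall j, 0 < rho j <= tau j ^ 2) -> punctured n x ->
  ex_series (fun j => bubble n rho l j x).
Proof.
  intros Hn Hrho Hx. destruct (bubble_loc_bdd n rho l x Hn Hrho Hx) as [r [C [J [Hr H]]]].
  apply (series_tail _ C J). intros j Hj. apply H; [assumption|apply Hx|assumption|].
  now rewrite Rnorm_self.
Qed.

Lemma smooth_family_bubble (n : nat) (rho : nat -> R) (j : nat) :
  (0 < n)%nat -> 0 < rho j -> smooth_family n (punctured n) (fun l => bubble n rho l j).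
Proof.
  intros Hn Hr. unfold bubble. apply smooth_family_lin; apply smooth_family_val; try assumption.
  - now apply inRn_axis.
  - intros x Hx. split; [apply Hx|now apply sq_axis_pos].
  - intros i _. reflexivity.
  - intros x Hx. split; [apply Hx|]. rewrite sq_origin. now apply punctured_nsq.
Qed.

Lemma punctured_open (n : nat) (x : nat -> R) : punctured n x ->
  exists r, 0 < r /\ forall y, inRn n y -> Rnorm n (fun j => y j - x j) < r -> punctured n y.
Proof.
  intro Hx. pose proof (punctured_pos n x Hx) as HR.
  exists (Rnorm n x / 2). split; [lra|]. intros y Hy Hd. split; [exact Hy|].
  pose proof (nsq_par n x y) as P. rewrite <- !Rnorm_sqr in P. intro H0. rewrite H0 in P.
  pose proof (Rnorm_pos n (fun k => y k - x k)). nra.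
Qed.

(** Since rho_j <= tau_j^2, the argument rho_j + |x - c_j|^2 is at most (|x| + 2 tau_j)^2, and ln (1
    + 2 tau_j/|x|) <= 2 tau_j/|x|. *)
Lemma bubble_lower (n : nat) (rho : nat -> R) (j : nat) (x : nat -> R) :
  0 < rho j <= tau j ^ 2 -> punctured n x ->
  0 <= bubble n rho nil j x + 4 / Rnorm n x * tau j.
Proof.
  intros Hr Hx. pose proof (punctured_pos n x Hx) as HR. destruct Hx as [Hx _].
  pose proof (Rabs_le_Rnorm n x 0 Hx) as H0. pose proof (tau_pos j) as [Ht1 Ht2].
  unfold bubble, val. simpl pds. cbn [eval]. rewrite sq_origin, <- Rnorm_sqr, ln_mult by assumption.
  set (R := Rnorm n x) in *.
  assert (Hs : ln (sq n (axis (tau j)) (rho j) x) <= ln ((R + 2 * tau j) * (R + 2 * tau j))).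
  { apply ln_le; [now apply sq_axis_pos|]. rewrite sq_axis, <- Rnorm_sqr. fold R.
    assert (- R <= x 0%nat) by (split_Rabs; lra). simpl in Hr |- *. nra. }
  rewrite ln_mult in Hs by lra.
  assert (HL : ln (R + 2 * tau j) - ln R <= 2 * tau j / R).
  { rewrite <- ln_div by lra.
    replace (2 * tau j / R) with ((R + 2 * tau j) / R - 1) by (field; lra).
    apply ln_le_sub_1. apply Rdiv_lt_0_compat; lra. }
  replace (4 / R * tau j) with (2 * (2 * tau j / R)) by (field; lra). lra.
Qed.

Lemma Series_ge_term (a : nat -> R) (i : nat) :
  (forall j, 0 <= a j) -> ex_series a -> a i <= Series a.
Proof.
  intros Ha He. rewrite (Series_incr_n a (S i)) by (lia || exact He).
  pose proof (sum_ge_term a (pred (S i)) i Ha ltac:(simpl; lia)).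
  assert (0 <= Series (fun k => a (S i + k)%nat)); [|lra].
  rewrite (Series_ext _ (fun k => Rabs (a (S i + k)%nat))) by
    (intro k; symmetry; apply Rabs_pos_eq, Ha).
  eapply Rle_trans; [apply Rabs_pos|apply Series_Rabs].
  apply (ex_series_ext (fun k => a (S i + k)%nat)).
  - intro k. symmetry. apply Rabs_pos_eq, Ha.
  - now apply (ex_series_incr_n a (S i)).
Qed.

Lemma is_series_tau : is_series tau 1.
Proof.
  replace 1 with (scal (/ 2) (/ (1 - / 2))) by (unfold scal; simpl; unfold mult; simpl; field; lra).
  apply (is_series_scal (V := R_NormedModule) (/ 2) (fun k => (/ 2) ^ k)).
  apply is_series_geom. rewrite Rabs_pos_eq; lra.
Qed.

Lemma Series_bubble_lower (n : nat) (rho : nat -> R) (i : nat) (x : nat -> R) :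
  (0 < n)%nat -> (forall j, 0 < rho j <= tau j ^ 2) -> punctured n x ->
  - 4 / Rnorm n x <= Series (fun j => bubble n rho nil j x) /\
  bubble n rho nil i x - 4 / Rnorm n x <= Series (fun j => bubble n rho nil j x).
Proof.
  intros Hn Hr Hx. pose proof (punctured_pos n x Hx) as HR.
  set (s := 4 / Rnorm n x).
  replace (- 4 / Rnorm n x) with (- s) by (unfold s; field; lra).
  assert (Hs : 0 < s) by (apply Rdiv_lt_0_compat; lra).
  assert (Ht : ex_series (fun j => s * tau j)).
  { exists (scal s 1). apply (is_series_scal (V := R_NormedModule)), is_series_tau. }
  pose proof (ex_series_bubble n rho nil x Hn Hr Hx) as HB.
  (* Adding [s * tau j] makes every term nonnegative at total cost s, so the corrected series
     dominates each of its terms. *)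
  assert (E : Series (fun j => bubble n rho nil j x + s * tau j) =
              Series (fun j => bubble n rho nil j x) + s).
  { rewrite Series_plus by assumption. rewrite Series_scal_l, (is_series_unique _ _ is_series_tau).
    ring. }
  assert (Hp : forall j, 0 <= bubble n rho nil j x + s * tau j).
  { intro j. now apply bubble_lower. }
  pose proof (Series_ge_term _ i Hp
    (ex_series_plus (V := R_NormedModule) _ _ HB Ht)) as H. cbv beta in H. rewrite E in H.
  pose proof (Hp i). pose proof (tau_pos i). split; nra.
Qed.

(** * The m-fold Laplacian of the solution and its bound by the exponential *)

Lemma lapm_bubble (m : nat) (rho : nat -> R) (j : nat) (x : nat -> R) :
  (0 < m)%nat -> 0 < rho j -> punctured (2 * m) x ->
  lapm (2 * m) (fun l => bubble (2 * m) rho l j) m nil x =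
    (-4) ^ m * INR (fact (2 * m - 1)) * rho j ^ m
      * (/ sq (2 * m) (axis (tau j)) (rho j) x) ^ (2 * m).
Proof.
  intros Hm Hr Hx. unfold bubble. rewrite lapm_lin, !lapm_Log; try assumption.
  (* The logarithm centred at the origin has rho = 0 and contributes the factor 0^m. *)
  - rewrite pow_i by assumption. ring.
  - rewrite sq_origin. now apply punctured_nsq.
  - now apply sq_axis_pos.
Qed.

Lemma exp_INR_mult (k : nat) (x : R) : exp (INR k * x) = exp x ^ k.
Proof.
  induction k as [|k IH]; [simpl; rewrite Rmult_0_l; apply exp_0|].
  rewrite S_INR, Rmult_plus_distr_r, exp_plus, IH, Rmult_1_l. simpl. ring.
Qed.

Lemma Series_le_tau (a : nat -> R) (A : R) :
  (forall j, 0 <= a j <= A * tau j) -> 0 <= Series a <= A.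
Proof.
  intro H.
  assert (HA : is_series (fun j => A * tau j) A).
  { pose proof (is_series_scal (V := R_NormedModule) A tau 1 is_series_tau : is_series _ (A * 1)) as HA.
    now rewrite Rmult_1_r in HA. }
  assert (He : ex_series a).
  { apply (ex_series_le (V := R_CompleteNormedModule) a (fun j => A * tau j)).
    - intro j. unfold norm; simpl; unfold abs; simpl. rewrite Rabs_pos_eq; apply H.
    - now exists A. }
  split.
  - eapply Rle_trans; [apply (H 0%nat)|]. apply Series_ge_term; [apply H|exact He].
  - rewrite <- (is_series_unique _ _ HA). apply Series_le; [exact H|now exists A].
Qed.

Lemma Rle_Rpower_self (u lam : R) : 1 <= u -> 1 <= lam -> u <= Rpower u lam.
Proof.
  intros Hu Hl. rewrite <- (Rpower_1 u) at 1 by lra. now apply Rle_Rpower.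
Qed.

Definition base (m : nat) : expr := Add (Mul (Cst (6 * INR m)) (Inv 1)) (Cst (6 * INR m + 1)).

Definition sol (m : nat) (rho : nat -> R) (l : list nat) (x : nat -> R) : R :=
  1 * val (2 * m) origin 0 (pds l (base m)) x
  + 2 * INR m * Series (fun j => bubble (2 * m) rho l j x).

Lemma smooth_family_sol (m : nat) (rho : nat -> R) :
  (0 < m)%nat -> (forall j, 0 < rho j <= tau j ^ 2) ->
  smooth_family (2 * m) (punctured (2 * m)) (sol m rho).
Proof.
  intros Hm Hr. unfold sol. apply smooth_family_lin.
  - apply smooth_family_val; [lia|intros i _; reflexivity|].
    intros x Hx. split; [apply Hx|]. rewrite sq_origin. now apply punctured_nsq.
  - apply smooth_family_Series.
    + intros x Hx. apply Hx.
    + apply punctured_open.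
    + intro j. apply smooth_family_bubble; [lia|apply Hr].
    + intros l x Hx. apply bubble_loc_bdd; [lia|assumption..].
Qed.

(** The first bound gives positivity and allows passing to the power lambda, the second gives the
    growth at c_i, and the third controls the i-th term of the Laplacian by e^u. *)
Lemma sol_lower (m : nat) (rho : nat -> R) (i : nat) (x : nat -> R) :
  (0 < m)%nat -> (forall j, 0 < rho j <= tau j ^ 2) -> punctured (2 * m) x ->
  1 <= sol m rho nil x /\
  1 + 2 * INR m * bubble (2 * m) rho nil i x <= sol m rho nil x /\
  - INR (2 * m) * ln (sq (2 * m) (axis (tau i)) (rho i) x) <= sol m rho nil x.
Proof.
  intros Hm Hr Hx. pose proof (punctured_pos _ x Hx) as HR.
  destruct (Series_bubble_lower (2 * m) rho i x ltac:(lia) Hr Hx) as [H1 H2].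
  unfold sol. simpl pds. unfold base, val at 1 2 3. cbn [eval]. rewrite sq_origin, <- Rnorm_sqr.
  set (S := Series (fun j => bubble (2 * m) rho nil j x)) in *.
  assert (HB : bubble (2 * m) rho nil i x =
    - ln (sq (2 * m) (axis (tau i)) (rho i) x) + 2 * ln (Rnorm (2 * m) x)).
  { unfold bubble, val. cbn [pds fold_right eval].
    rewrite sq_origin, <- Rnorm_sqr, ln_mult by assumption. ring. }
  assert (HL : - ln (Rnorm (2 * m) x) <= / Rnorm (2 * m) x).
  { rewrite <- ln_Rinv by assumption.
    pose proof (ln_le_sub_1 _ (Rinv_0_lt_compat _ HR)). lra. }
  rewrite mult_INR. simpl (INR 2).
  assert (HM : 1 <= INR m) by (apply (le_INR 1); lia).
  rewrite pow_1, Rinv_mult. unfold Rdiv in H1, H2.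
  set (s := / Rnorm (2 * m) x) in *.
  set (B := bubble (2 * m) rho nil i x) in *.
  set (L := ln (sq (2 * m) (axis (tau i)) (rho i) x)) in *.
  set (ell := ln (Rnorm (2 * m) x)) in *.
  assert (P1 : 0 <= INR m * (6 * (s * s) - 8 * s + 6)) by (apply Rmult_le_pos; nra).
  assert (P2 : 0 <= INR m * (S - (-4 * s))) by (apply Rmult_le_pos; lra).
  assert (P3 : 0 <= INR m * (S - (B - 4 * s))) by (apply Rmult_le_pos; lra).
  (* The tight case, which explains the constant 6 in [base]. With s = 1/|x|, the negative parts of
     the series cost 8ms and 4m ln |x| costs at most another 4ms; against 6m s^2 + 6m this leaves 6m
     (s - 1)^2. *)
  assert (P4 : 0 <= INR m * (6 * (s * s) - 12 * s + 6)).
  { pose proof (Rle_0_sqr (s - 1)) as Hsq. unfold Rsqr in Hsq. apply Rmult_le_pos; lra. }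
  assert (P5 : 0 <= INR m * (s + ell)) by (apply Rmult_le_pos; lra).
  repeat split; nra.
Qed.

Lemma lapm_sol (m : nat) (rho : nat -> R) (x : nat -> R) :
  Nat.odd m = true -> (2 <= m)%nat -> (forall j, 0 < rho j <= tau j ^ 2) ->
  (forall j, 2 * INR m * (4 ^ m * INR (fact (2 * m - 1))) * rho j ^ m <= tau j) ->
  punctured (2 * m) x ->
  0 <= - lapm (2 * m) (sol m rho) m nil x <= exp (sol m rho nil x).
Proof.
  intros Ho Hm Hr Hk Hx. set (Q := 4 ^ m * INR (fact (2 * m - 1))) in *.
  destruct (lapm_Series (2 * m) (bubble (2 * m) rho) m nil x) as [_ E].
  { intro l. apply ex_series_bubble; [lia|assumption..]. }
  assert (E' : - lapm (2 * m) (sol m rho) m nil x =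
     Series (fun j => 2 * INR m * Q * rho j ^ m
       * (/ sq (2 * m) (axis (tau j)) (rho j) x) ^ (2 * m))).
  { unfold sol. rewrite lapm_lin, E. unfold base.
    rewrite lapm_Inv1 by (assumption || (rewrite sq_origin; now apply punctured_nsq)).
    rewrite Rmult_0_r, Rplus_0_l, <- Series_scal_l, <- Series_opp.
    apply Series_ext. intro j. rewrite lapm_bubble by (lia || assumption || apply Hr).
    (* Oddness of m enters here: it gives every term of the series a positive sign. *)
    replace ((-4) ^ m) with (- 4 ^ m); [unfold Q; ring|].
    apply Nat.odd_spec in Ho. destruct Ho as [p ->].
    replace (-4) with (-1 * 4) by ring. rewrite Rpow_mult_distr, Nat.add_1_r, pow_1_odd. ring. }
  rewrite E'. apply Series_le_tau. intro j.
  pose proof (sq_axis_pos (2 * m) (tau j) (rho j) x (proj1 (Hr j))) as Hs.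
  destruct (sol_lower m rho j x ltac:(lia) Hr Hx) as [_ [_ H]].
  assert (Hq : 0 < (/ sq (2 * m) (axis (tau j)) (rho j) x) ^ (2 * m)).
  { apply pow_lt. now apply Rinv_0_lt_compat. }
  (* The left side is exp (-2m ln s), so this is the exponential of the third bound in [sol_lower].
     The prefactor then supplies tau_j, and the tau_j sum to 1. *)
  assert (Hq' : (/ sq (2 * m) (axis (tau j)) (rho j) x) ^ (2 * m) <= exp (sol m rho nil x)).
  { rewrite <- (exp_ln (sq _ _ _ _) Hs), <- exp_Ropp, <- exp_INR_mult.
    destruct (Rle_lt_or_eq_dec _ _ H) as [Hlt|Heq].
    - left. apply exp_increasing. lra.
    - right. f_equal. lra. }
  specialize (Hk j).
  assert (HQ : 0 <= 2 * INR m * Q * rho j ^ m).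
  { unfold Q. pose proof (pos_INR m). pose proof (pos_INR (fact (2 * m - 1))).
    pose proof (pow_le (rho j) m (Rlt_le _ _ (proj1 (Hr j)))).
    pose proof (pow_le 4 m ltac:(lra)).
    repeat apply Rmult_le_pos; lra. }
  split; [nra|]. rewrite (Rmult_comm (exp _)).
  apply Rmult_le_compat; lra.
Qed.

(** * Choice of the rho_j and growth along the points c_j *)

Theorem theorem1p11 (m : nat) (lam : R) (phi : R -> R) :
  Nat.odd m = true -> (3 <= m)%nat -> 1 <= lam ->
  (forall r, 0 < r < 1 -> 0 < phi r) ->
  (forall r, 0 < r < 1 -> continuity_pt phi r) ->
  (forall M, exists delta, 0 < delta /\
     forall r, 0 < r < delta -> r < 1 -> M < phi r) ->
  exists (u : (nat -> R) -> R) (D : list nat -> (nat -> R) -> R),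
    D nil = u /\
    smooth_family (2 * m) (punctured (2 * m)) D /\
    (forall x, punctured (2 * m) x ->
       0 < u x /\
       0 <= - lapm (2 * m) D m nil x <= exp (Rpower (u x) lam)) /\
    (forall M delta, 0 < delta -> exists x,
       inRn (2 * m) x /\ 0 < Rnorm (2 * m) x < delta /\ Rnorm (2 * m) x < 1 /\
       M < u x / phi (Rnorm (2 * m) x)).
Proof.
  intros Ho Hm Hlam Hphi _ _.
  set (Q := 2 * INR m * (4 ^ m * INR (fact (2 * m - 1)))).
  assert (HM : 1 <= INR m) by (apply (le_INR 1); lia).
  assert (HQ : 1 <= Q).
  { assert (1 <= 4 ^ m) by (apply pow_R1_Rle; lra).
    assert (1 <= INR (fact (2 * m - 1))) by (apply (le_INR 1), lt_O_fact).
    assert (1 <= 4 ^ m * INR (fact (2 * m - 1))) by nra. unfold Q. nra. }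
  (* Each factor has one purpose: tau_j^2 makes the series converge, 1/[Q] compensates the constant
     of the m-fold Laplacian, and the exponential forces ln (tau_j^2/rho_j) >= j phi(tau_j). *)
  set (rho := fun j => tau j ^ 2 * exp (- (INR j * phi (tau j))) / Q).
  assert (Hphij : forall j, 0 < phi (tau j)).
  { intro j. apply Hphi. pose proof (tau_pos j). lra. }
  assert (Hrho0 : forall j, 0 < rho j).
  { intro j. unfold rho. pose proof (tau_pos j) as [Ht _].
    pose proof (exp_pos (- (INR j * phi (tau j)))).
    apply Rdiv_lt_0_compat; [|lra]. apply Rmult_lt_0_compat; [apply pow_lt|]; lra. }
  assert (HQr : forall j, Q * rho j = tau j ^ 2 * exp (- (INR j * phi (tau j)))).
  { intro j. unfold rho. field. lra. }
  assert (Hexp : forall j, exp (- (INR j * phi (tau j))) <= 1).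
  { intro j. rewrite <- exp_0.
    destruct (Req_dec (INR j * phi (tau j)) 0) as [->|Hne]; [rewrite Ropp_0; lra|].
    left. apply exp_increasing.
    pose proof (Rmult_le_pos _ _ (pos_INR j) (Rlt_le _ _ (Hphij j))). lra. }
  assert (HQr1 : forall j, Q * rho j <= tau j ^ 2).
  { intro j. rewrite HQr. pose proof (pow2_ge_0 (tau j)). specialize (Hexp j). nra. }
  assert (Hrho : forall j, 0 < rho j <= tau j ^ 2).
  { intro j. split; [apply Hrho0|]. specialize (HQr1 j). specialize (Hrho0 j). nra. }
  assert (Hk : forall j, 2 * INR m * (4 ^ m * INR (fact (2 * m - 1))) * rho j ^ m <= tau j).
  { intro j. fold Q. pose proof (tau_pos j) as [Ht1 Ht2].
    assert (Ht : tau j ^ 2 <= tau j) by (simpl; nra).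
    apply Rle_trans with (Q * rho j); [|specialize (HQr1 j); lra].
    (* As rho_j <= 1 and m >= 1, rho_j^m <= rho_j. *)
    apply Rmult_le_compat_l; [lra|]. rewrite <- (pow_1 (rho j)) at 2.
    destruct m as [|p]; [lia|]. rewrite pow_1. simpl pow.
    rewrite <- (Rmult_1_r (rho j)) at 3. apply Rmult_le_compat_l; [apply Rlt_le, Hrho0|].
    rewrite <- (pow1 p). apply pow_incr. specialize (Hrho j). lra. }
  exists (sol m rho nil), (sol m rho). split; [reflexivity|]. split; [|split].
  - apply smooth_family_sol; [lia|assumption].
  - intros x Hx. destruct (sol_lower m rho 0 x ltac:(lia) Hrho Hx) as [H1 _].
    destruct (lapm_sol m rho x Ho ltac:(lia) Hrho Hk Hx) as [L1 L2].
    split; [lra|]. split; [exact L1|]. eapply Rle_trans; [exact L2|].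
    destruct (Rle_Rpower_self _ lam H1 Hlam) as [Hlt|Heq].
    + left. now apply exp_increasing.
    + right. now f_equal.
  - intros M delta Hd.
    destruct (pow_half_small 1 delta Hd) as [N0 HN0].
    destruct (INR_unbounded M) as [N1 HN1].
    (* [N0] puts c_j within distance delta of the origin, and [N1] makes j exceed M. *)
    set (j := max N0 N1). pose proof (tau_pos j) as [Ht1 Ht2].
    assert (HN : Rnorm (2 * m) (axis (tau j)) = tau j).
    { apply Rsqr_inj; [apply Rnorm_pos|lra|]. unfold Rsqr. rewrite Rnorm_sqr, nsq_axis. ring. }
    assert (Hin : inRn (2 * m) (axis (tau j))) by (apply inRn_axis; lia).
    exists (axis (tau j)). rewrite HN. split; [exact Hin|].
    split; [split; [exact Ht1|]|split; [lra|]].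
    + specialize (HN0 j ltac:(lia)). unfold tau in *. simpl pow in *.
      pose proof (pow_lt (/ 2) j ltac:(lra)). lra.
    + destruct (sol_lower m rho j (axis (tau j)) ltac:(lia) Hrho) as [_ [H _]].
      { split; [exact Hin|]. rewrite HN. lra. }
      assert (HB : INR j * phi (tau j) <= bubble (2 * m) rho nil j (axis (tau j))).
      { unfold bubble, val. cbn [pds fold_right eval]. rewrite sq_axis, sq_origin, nsq_axis.
        unfold axis at 1. simpl Nat.eqb. cbv iota.
        (* At x = c_j the distance to the centre vanishes, so T_j equals ln (tau_j^2/rho_j). *)
        replace (rho j + tau j ^ 2 - 2 * tau j * tau j + tau j ^ 2) with (rho j) by ring.
        assert (Hl : ln (rho j) <= ln (tau j ^ 2 * exp (- (INR j * phi (tau j))))).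
        { apply ln_le; [apply Hrho0|]. rewrite <- HQr. specialize (Hrho0 j). nra. }
        rewrite ln_mult, ln_exp in Hl by (apply exp_pos || (apply pow_lt; lra)). lra. }
      apply Rlt_le_trans with (INR j).
      * eapply Rlt_le_trans; [exact HN1|]. apply le_INR. unfold j; lia.
      (* The second bound of [sol_lower] gives u(c_j) >= 1 + 2m j phi(tau_j), which is at least j
         phi(tau_j). *)
      * specialize (Hphij j). apply Rmult_le_reg_r with (phi (tau j)); [exact Hphij|].
        unfold Rdiv. rewrite Rmult_assoc, Rinv_l, Rmult_1_r by lra.
        pose proof (Rmult_le_pos _ _ (pos_INR j) (Rlt_le _ _ Hphij)). nra.
Qed.
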